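(* Let $G=(V,E)$ be a finite graph. The following statements are equivalent: (1) Every assignment $w:V\to\mathbb{N}_0$ is equatable in $G$. (2) $G$ is connected, $|V|$ is odd, and for every nonempty $U\subseteq V$ the graph $G-U$ has fewer than $|U|$ isolated vertices, where $G-U$ denotes the subgraph of $G$ induced by $V\setminus U$.
   Context: For a weight function $w:V\to\mathbb{N}_0$ on the vertices of $G$ and an edge $e=\{u,v\}\in E$, a positive step on $e$ modifies $w$ by increasing each of $w(u)$ and $w(v)$ by $1$. The assignment $w$ is called equatable in $G$ if there is a finite sequence of positive steps (on edges of $G$, repetitions allowed) after which all vertices have the same weight. *)

(* Defs.v *)
From mathcomp Require Import all_boot.
Set Implicit Arguments. Unset Strict Implicit. Unset Printing Implicit Defensive.

(* Finite simple graphs; the empty graph is allowed, since G - U may be empty. *)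
Record sgraph := SGraph {
  vertex :> finType;
  adj : rel vertex;
  adj_sym : symmetric adj;
  adj_irr : irreflexive adj }.
Arguments adj {s} _ _ : rename.

Section Induced.
Variables (G : sgraph) (A : {set G}).

Definition induced_adj : rel {x : G | x \in A} := fun x y => adj (val x) (val y).

Lemma induced_adj_sym : symmetric induced_adj.
Proof. by move=> x y; apply: adj_sym. Qed.

Lemma induced_adj_irr : irreflexive induced_adj.
Proof. by move=> x; apply: adj_irr. Qed.

Definition induced : sgraph := SGraph induced_adj_sym induced_adj_irr.
End Induced.

Definition remove_vertices (G : sgraph) (U : {set G}) : sgraph := induced (~: U).

Definition isolated (G : sgraph) : {set G} := [set x | [forall y, ~~ adj x y]].

Definition connected (G : sgraph) : Prop := forall x y : G, connect adj x y.

(* An edge {u, v} is encoded by either of the ordered pairs (u, v), (v, u). *)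
Definition positive_step (G : sgraph) (w : {ffun G -> nat}) (e : G * G) :
    {ffun G -> nat} :=
  [ffun x => if (x == e.1) || (x == e.2) then (w x).+1 else w x].

Definition equatable (G : sgraph) (w : {ffun G -> nat}) : Prop :=
  exists s : seq (G * G),
    all (fun e => adj e.1 e.2) s /\
    forall x y : G, foldl (@positive_step G) w s x = foldl (@positive_step G) w s y.

(* Main.v *)
Require Import Defs.
From mathcomp Require Import all_boot.
Set Implicit Arguments. Unset Strict Implicit. Unset Printing Implicit Defensive.

(**
  Necessity is counting.  A step inside a set D closed under adjacency changes
  the weight of D by an even amount, so starting from the indicator of a vertex
  of D forces #|D| to be odd; applied to V, to a component and to its
  complement this gives oddness and connectedness.  If I is the set of isolated
  vertices of G - U, a step raises the weight of U at least as much as that of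
  I, so the indicator of U cannot be equated when #|U| <= #|I|.

  Sufficiency: condition (2) implies that #|N(S)| > #|S| for every nonempty
  proper S, so by Hall's theorem there is, for all vertices v and u, a bijection
  V \ v -> V \ u along edges.  A step on each edge {x, f x} adds 2 everywhere
  except for a defect of 1 at v and of 1 at u (2 if u = v).  Hence, up to
  constants, the weight can be decremented at any two vertices at once, and
  since #|V| is odd, w or w + 1 has an even sum and can be decremented to 0.
*)

(** * Hall's marriage theorem *)

Section Hall.
Variables T T' : finType.
Implicit Types (A B S : {set T}) (C : {set T'}) (N : T -> {set T'}).

Definition hall_condition N A :=
  forall S, S \subset A -> #|S| <= #|\bigcup_(x in S) N x|.

Definition matching N A (f : T -> T') :=
  {in A, forall x, f x \in N x} /\ {in A &, injective f}.

Lemma matching_glue N A B C f g :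
    {in B, forall x, f x \in C} -> matching N B f ->
    matching (fun x => N x :\: C) (A :\: B) g ->
  matching N A (fun x => if x \in B then f x else g x).
Proof.
move=> fC [fN fI] [gN gI].
have gP x : x \in A -> x \notin B -> g x \notin C /\ g x \in N x.
  by move=> xA xB; move: (gN x); rewrite !inE xA xB => /(_ isT) /andP[].
split=> [x xA|x y xA yA].
  by case: ifPn => [/fN //|xB]; case: (gP x xA xB).
case: ifPn => xB; case: ifPn => yB.
- exact: fI.
- by move=> E; case: (gP y yA yB); rewrite -E fC.
- by move=> E; case: (gP x xA xB); rewrite E fC.
- by apply: gI; rewrite inE ?xA ?yA ?xB ?yB.
Qed.

(** Induction on [#|A|], split on whether some nonempty proper subset of [A] is tight, that is, has
    no more neighbours than elements. [y0] is a default value for empty [A]. *)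
Theorem hall (y0 : T') N A :
  hall_condition N A -> exists f, matching N A f.
Proof.
have [n] := ubnP #|A|; elim: n => // n IHn in N A * => ltAn hallA.
have [A0|[a aA]] := set_0Vmem A.
  by exists (fun=> y0); split=> [x|x y]; rewrite A0 inE.
(* It is enough to match part of [A] into some [C] so that Hall's condition survives for the rest
   once [C] is forbidden. *)
suff [B [C [f [B0 [fC fB hallD]]]]] : exists B C f,
    B :&: A != set0 /\ [/\ {in B, forall x, f x \in C}, matching N B f
      & hall_condition (fun x => N x :\: C) (A :\: B)].
  have [|g gP] := IHn _ _ _ hallD.
    apply: leq_trans (ltAn : #|A| <= n); rewrite -(cardsID B A) setIC.
    by rewrite -[X in X < _]add0n ltn_add2r card_gt0.
  by exists (fun x => if x \in B then f x else g x); apply: matching_glue gP.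
have [/existsP[S /and3P[S0 SA tight]]|] :=
  boolP [exists S : {set T},
    [&& S != set0, S \proper A & #|\bigcup_(x in S) N x| <= #|S|]].
  have [||f fP] := IHn N S.
  - exact: leq_trans (proper_card SA) ltAn.
  - by move=> S' sS'; apply: hallA (subset_trans sS' (proper_sub SA)).
  exists S, (\bigcup_(x in S) N x), f; split; last split => //.
  - by rewrite (setIidPl (proper_sub SA)).
  - by move=> x xS; apply/bigcupP; exists x => //; case: fP => ->.
  move=> S' sS'.
  have dSS' : [disjoint S & S'].
    by rewrite disjoint_sym; move: sS'; rewrite subsetD => /andP[].
  (* Hall's condition for the union, minus the at most [#|S|] neighbours of the tight set [S],
     leaves at least [#|S'|] for [S']. *)
  have := hallA (S :|: S'); rewrite subUset (proper_sub SA).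
  rewrite (subset_trans sS' (subsetDl _ _)) => /(_ isT).
  rewrite cardsU disjoint_setI0 // cards0 subn0 => le1.
  rewrite -(leq_add2l #|S|) (leq_trans le1) //.
  apply: leq_trans (_ : #|\bigcup_(x in S) N x| +
     #|\bigcup_(x in S') (N x :\: \bigcup_(y in S) N y)| <= _); last first.
    by rewrite leq_add2r.
  apply: leq_trans (leq_card_setU _ _); apply: subset_leq_card.
  apply/subsetP=> y /bigcupP[x xSS' yN].
  rewrite in_setU; have [//|yS] := boolP (y \in \bigcup_(x in S) N x).
  apply/bigcupP; exists x; last by rewrite inE yS.
  case/setUP: xSS' => // xS; by case/bigcupP: yS; exists x.
(* Without tight sets, [a] may take any neighbour [b]: losing [b] costs one, and every nonempty
   proper subset has one to spare. *)
move/existsPn => slack.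
have [b bN] : exists b, b \in N a.
  apply/set0Pn; rewrite -card_gt0.
  by have := hallA [set a]; rewrite sub1set aA cards1 big_set1 => ->.
exists [set a], [set b], (fun=> b); split; last split.
- by apply/set0Pn; exists a; rewrite !inE eqxx.
- by move=> x _; rewrite inE.
- by split=> [x /set1P-> //|x y /set1P-> /set1P->].
move=> S sS; have [->|S0] := eqVneq S set0; first by rewrite cards0.
have aS : a \notin S by apply/negP => /(subsetP sS); rewrite !inE eqxx.
have pS : S \proper A.
  apply/properP; split; last by exists a.
  exact: subset_trans sS (subsetDl _ _).
have := slack S; rewrite S0 pS /= -ltnNge => ltS.
rewrite -ltnS (leq_trans ltS) //.
rewrite -add1n -(cards1 b); apply: leq_trans (leq_card_setU _ _).
apply: subset_leq_card; apply/subsetP=> y /bigcupP[x xS yN].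
rewrite !inE; have [//|yb] := eqVneq y b.
by apply/bigcupP; exists x; rewrite // !inE yb.
Qed.

End Hall.

Lemma sum_eq_mem (T : finType) (A : {set T}) z :
  \sum_(x in A) (x == z) = (z \in A).
Proof.
have [zA|zA] := boolP (z \in A).
  by rewrite (bigD1 z) //= eqxx big1 // => x /andP[_ /negPf->].
by rewrite big1 // => x xA; case: eqP zA => // <-; rewrite xA.
Qed.

(** * Total effect of a sequence of steps, and the counting behind necessity *)

Section Steps.
Variable G : sgraph.
Implicit Types (s : seq (G * G)) (w : {ffun G -> nat}) (D I U : {set G}).

Definition load s (x : G) := \sum_(e <- s) ((x == e.1) + (x == e.2)).

Lemma load_cat s1 s2 x : load (s1 ++ s2) x = load s1 x + load s2 x.
Proof. exact: big_cat. Qed.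

Lemma foldl_stepE w s x : all (fun e => adj e.1 e.2) s ->
  foldl (@positive_step G) w s x = w x + load s x.
Proof.
elim: s w => [|e s IHs] w /=; first by rewrite /load big_nil addn0.
case/andP=> ade ads; rewrite IHs // /load big_cons ffunE addnA; congr (_ + _).
have [->|_] := eqVneq x e.1; last by case: eqP; rewrite ?addn0 ?addn1.
(* On a loop [load] would count 2 where [positive_step] adds 1. *)
have /negPf-> : e.1 != e.2 by apply: contraTneq ade => ->; rewrite adj_irr.
by rewrite addn1.
Qed.

Lemma sum_load s D :
  \sum_(x in D) load s x = \sum_(e <- s) ((e.1 \in D) + (e.2 \in D)).
Proof.
rewrite exchange_big; apply: eq_bigr => e _.
by rewrite big_split /= !sum_eq_mem.
Qed.

Lemma equatableP w : equatable w <->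
  exists s c, all (fun e => adj e.1 e.2) s /\ forall x, w x + load s x = c.
Proof.
split=> [[s [ads eqs]]|[s [c [ads eqs]]]]; last first.
  by exists s; split=> // x y; rewrite !foldl_stepE // !eqs.
have [x0|G0] := pickP (@predT G); last by exists s, 0; split => // x; have := G0 x.
exists s, (w x0 + load s x0); split=> // x.
by rewrite -!foldl_stepE.
Qed.

Lemma sum_equated w s c D : (forall x, w x + load s x = c) ->
  \sum_(x in D) w x + \sum_(e <- s) ((e.1 \in D) + (e.2 \in D)) = #|D| * c.
Proof.
move=> eqs; rewrite -sum_load -big_split -sum_nat_const.
by apply: eq_bigr => x _; apply: eqs.
Qed.

Definition indicator D : {ffun G -> nat} := [ffun x => x \in D : nat].

Lemma sum_indicator D U : \sum_(x in D) indicator U x = #|D :&: U|.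
Proof.
rewrite -sum1_card [RHS](eq_bigl (fun x => (x \in D) && (x \in U))); last first.
  by move=> x; rewrite inE.
by rewrite big_mkcondr; apply: eq_bigr => x _; rewrite ffunE; case: (x \in U).
Qed.

(** Each edge has both or neither endpoint in [D], so [#|D| * c] is 1 plus an even number. *)
Lemma equatable_closed_odd D z : z \in D ->
    (forall x y, adj x y -> (x \in D) = (y \in D)) ->
  equatable (indicator [set z]) -> odd #|D|.
Proof.
move=> zD closD /equatableP[s [c [ads eqs]]].
have := congr1 odd (sum_equated D eqs).
rewrite sum_indicator (setIidPr _) ?sub1set // cards1 oddD oddM /=.
suff -> : odd (\sum_(e <- s) ((e.1 \in D) + (e.2 \in D))) = false.
  by move=> /esym/andP[].
elim: s ads {eqs} => [|e s IHs] /=; first by rewrite big_nil.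
case/andP=> ade ads; rewrite big_cons oddD IHs // addbF oddD.
by rewrite (closD _ _ ade) addbb.
Qed.

Lemma equatable_isolating I U : U != set0 ->
    (forall x y, adj x y -> x \in I -> y \in U) -> [disjoint I & U] ->
  equatable (indicator U) -> #|I| < #|U|.
Proof.
move=> U0 IU dIU /equatableP[s [c [ads eqs]]].
have := sum_equated I eqs; have := sum_equated U eqs.
rewrite !sum_indicator setIid disjoint_setI0 // cards0 add0n => EU EI.
have le_s : \sum_(e <- s) ((e.1 \in I) + (e.2 \in I))
         <= \sum_(e <- s) ((e.1 \in U) + (e.2 \in U)).
  elim: s ads {eqs EU EI} => [|e s IHs] /=; first by rewrite !big_nil.
  (* The swap charges each endpoint in [I] to the opposite endpoint, which lies in [U]. *)
  case/andP=> ade ads; rewrite !big_cons leq_add ?IHs // addnC.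
  apply: leq_add.
    by case: (boolP (e.2 \in I)) => // /(IU e.2 e.1)->; rewrite // adj_sym.
  by case: (boolP (e.1 \in I)) => // /(IU e.1 e.2)->.
have : #|I| * c < #|U| * c.
  by rewrite -EI -EU -[X in X < _]add0n -addSn leq_add ?card_gt0.
by rewrite ltn_mul2r => /andP[].
Qed.

Lemma isolated_removeP U x :
  reflect (x \notin U /\ forall y, adj x y -> y \in U)
          (x \in [set val z | z in isolated (remove_vertices U)]).
Proof.
apply: (iffP imsetP) => [[z /[!inE] /forallP zI ->]|[xU adx]].
  split=> [|y ady]; first by have := valP z; rewrite inE.
  apply: contraT => yU; have yU' : y \in ~: U by rewrite inE.
  by have := zI (Sub y yU'); rewrite /= /induced_adj /= ady.
have xU' : x \in ~: U by rewrite inE.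
exists (Sub x xU' : remove_vertices U) => //; rewrite inE; apply/forallP => y.
apply/negP => /adx; have := valP y.
by rewrite inE => /negP.
Qed.

Lemma card_isolated_remove U :
  #|[set val z | z in isolated (remove_vertices U)]|
  = #|isolated (remove_vertices U)|.
Proof. by rewrite card_imset //; apply: val_inj. Qed.

End Steps.

(** * Expansion of neighbourhoods and decrementing, for sufficiency *)

Section Decrement.
Variable G : sgraph.
Hypothesis G_conn : connected G.
Hypothesis G_iso : forall U : {set G},
  U != set0 -> #|isolated (remove_vertices U)| < #|U|.
Implicit Types (S : {set G}) (t : seq G).

Definition nbr S : {set G} := \bigcup_(x in S) [set y | adj x y].

Lemma nbrP S y : reflect (exists2 x, x \in S & adj x y) (y \in nbr S).
Proof.
by apply: (iffP bigcupP) => -[x xS ad]; exists x => //; move: ad; rewrite inE.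
Qed.

Lemma connected_closed_setT S :
  S != set0 -> (forall x y, adj x y -> x \in S -> y \in S) -> S = setT.
Proof.
case/set0Pn=> x xS clS; apply/setP => y; rewrite inE.
have closS : closed (@adj G) (mem S).
  by move=> a b ab; apply/idP/idP; apply: clS; rewrite // adj_sym.
by rewrite -(closed_connect closS (G_conn x y)).
Qed.

(** If [S] lies in [nbr S], equality would make [S] closed, against connectedness. Otherwise the
    vertices of [I], those of [S] outside [nbr S], are isolated once [nbr I] is removed, so
    [#|I| < #|nbr I|]; and [nbr S] contains the disjoint sets [S :&: nbr S] and [nbr I]. *)
Lemma nbr_expand S : S != set0 -> S != setT -> #|S| < #|nbr S|.
Proof.
move=> S0 ST; have [sSN|] := boolP (S \subset nbr S).
  apply: proper_card; rewrite properE sSN; apply: contra ST => sNS.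
  apply/eqP/connected_closed_setT => // x y ad xS.
  by apply: (subsetP sNS); apply/nbrP; exists x.
rewrite -setD_eq0; set I := S :\: nbr S => I0.
have dSU : [disjoint S & nbr I].
  rewrite -setI_eq0; apply/eqP/setP => y; rewrite !inE; apply/andP => -[yS].
  case/nbrP=> x; rewrite inE => /andP[/nbrP xN _] ad.
  by case: xN; exists y; rewrite // adj_sym.
have U0 : nbr I != set0.
  apply: contra ST => /eqP U0; have IT : I = setT.
    apply: connected_closed_setT => // x y ad xI.
    by have : y \in nbr I; [apply/nbrP; exists x | rewrite U0 inE].
  by rewrite -subTset -IT subsetDl.
have leI : #|I| <= #|isolated (remove_vertices (nbr I))|.
  rewrite -card_isolated_remove; apply: subset_leq_card; apply/subsetP => x xI.
  apply/isolated_removeP; split=> [|y ad]; last by apply/nbrP; exists x.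
  by case/setDP: xI => xS _; rewrite (disjointFr dSU).
rewrite -(cardsID (nbr S)) -/I.
apply: leq_trans (_ : #|S :&: nbr S| + #|nbr I| <= _).
  by rewrite -addnS leq_add2l (leq_ltn_trans leI) ?G_iso.
have dU : (S :&: nbr S) :&: nbr I = set0.
  by apply/disjoint_setI0/(disjointWl (subsetIl _ _) dSU).
rewrite -[leqLHS]subn0 -(cards0 G) -dU -cardsU subset_leq_card //.
rewrite subUset subsetIr /=; apply/subsetP => y /nbrP[x /setDP[xS _] ad].
by apply/nbrP; exists x.
Qed.

(** Sets avoiding [v] are proper, so they expand strictly, and Hall's condition survives forbidding
    the target [u]. Equal cardinalities make the matching onto. *)
Lemma near_perfect_matching (v u : G) :
  exists2 f : G -> G, {in [set~ v], forall x, adj x (f x)} &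
    {in [set~ v] &, injective f} /\ f @: [set~ v] = [set~ u].
Proof.
have [|f [fN fI]] := @hall G G u (fun x => [set y | adj x y] :\ u) [set~ v].
  move=> S sS; have [->|S0] := eqVneq S set0; first by rewrite cards0.
  have ST : S != setT.
    apply: contraTneq sS => ->; apply/negP => /subsetP/(_ v).
    by rewrite !inE eqxx => /(_ isT).
  rewrite -ltnS (leq_trans (nbr_expand S0 ST)) //.
  rewrite -add1n -(cards1 u); apply: leq_trans (leq_card_setU _ _).
  apply: subset_leq_card; apply/subsetP=> y /nbrP[x xS ad].
  rewrite !inE; have [//|yu] := eqVneq y u.
  by apply/bigcupP; exists x; rewrite // !inE yu.
exists f; first by move=> x /fN; rewrite !inE => /andP[].
split=> //; apply/eqP; rewrite eqEcard card_in_imset // !cardsC1 leqnn andbT.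
by apply/subsetP => y /imsetP[x /fN /[!inE] /andP[yu _] ->].
Qed.

(** The sequence [t] stands for a multiset: [s] adds [c] everywhere, less one for each occurrence in
    [t]. *)
Definition decrementable t := exists s c,
  all (fun e => adj e.1 e.2) s /\ forall x : G, count_mem x t + load s x = c.

Lemma decrementable2 v u : decrementable [:: v; u].
Proof.
have [f adf [fI fE]] := near_perfect_matching v u.
(* Each vertex is a source once, except [v], and a target once, except [u]; hence the constant 2. *)
exists [seq (x, f x) | x in [set~ v]], 2; split.
  by apply/allP => e /imageP[x xv ->]; apply: adf.
move=> x; rewrite /load big_image /=.
under eq_bigr do rewrite !(eq_sym x).
rewrite big_split /= sum_eq_mem -(big_imset (fun y => nat_of_bool (y == x)) fI) fE.
by rewrite sum_eq_mem !inE !(eq_sym x); do 2!case: eqP.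
Qed.

Lemma decrementable_cat t1 t2 :
  decrementable t1 -> decrementable t2 -> decrementable (t1 ++ t2).
Proof.
move=> [s1 [c1 [ad1 E1]]] [s2 [c2 [ad2 E2]]].
exists (s1 ++ s2), (c1 + c2); split; first by rewrite all_cat ad1.
by move=> x; rewrite count_cat load_cat addnACA E1 E2.
Qed.

Lemma decrementable_even t : ~~ odd (size t) -> decrementable t.
Proof.
have [n] := ubnP (size t); elim: n => // n IHn in t *.
case: t => [|v [|u t]] //= ltn; last rewrite negbK => ev.
  by exists [::], 0; split=> // x; rewrite /load big_nil.
apply: (@decrementable_cat [:: v; u]); first exact: decrementable2.
by apply: IHn => //; apply: ltnW.
Qed.

Lemma multiset_seq (f : G -> nat) :
  exists2 t : seq G, size t = \sum_x f x & forall x, count_mem x t = f x.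
Proof.
exists (flatten [seq nseq (f x) x | x <- enum G]).
  rewrite size_flatten /shape -map_comp sumnE big_map big_enum.
  by apply: eq_bigr => x _; rewrite /= size_nseq.
move=> x; rewrite count_flatten -map_comp sumnE big_map big_enum.
rewrite (bigD1 x) //= count_nseq /= eqxx mul1n big1 ?addn0 // => y /negPf yx.
by rewrite count_nseq /= yx.
Qed.

Lemma equatable_of_decrement (w : {ffun G -> nat}) : odd #|G| -> equatable w.
Proof.
(* Adding the parity bit of the total at each of an odd number of vertices makes the total even. *)
move=> oddG; have [t szt ctt] := multiset_seq (fun x => odd (\sum_y w y) + w x).
have [|s [c [ads eqs]]] := @decrementable_even t.
  rewrite szt big_split sum_nat_const oddD oddM oddG /=.
  by rewrite oddb addbb.
(* The subtraction does not truncate, since [c] includes the bit as a summand. *)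
apply/equatableP; exists s, (c - odd (\sum_y w y)); split=> // x.
by rewrite -(eqs x) ctt -addnA addKn.
Qed.

End Decrement.

Theorem theorem1 (G : sgraph) (G_nonempty : 0 < #|G|) :
  (forall w : {ffun G -> nat}, equatable w) <->
  [/\ connected G, odd #|G| &
      forall U : {set G}, U != set0 -> #|isolated (remove_vertices U)| < #|U|].
Proof.
split=> [eqG|[G_conn oddG G_iso] w]; last exact: equatable_of_decrement.
have oddG : odd #|G|.
  have /card_gt0P[z _] := G_nonempty.
  rewrite -cardsT; apply: (@equatable_closed_odd G setT z) => // x y _.
  by rewrite !inE.
split=> // [x y|U U0]; last first.
  rewrite -card_isolated_remove; apply: equatable_isolating => //.
    by move=> x y ad /isolated_removeP[_]; apply.
  rewrite -setI_eq0; apply/eqP/setP => x; rewrite !inE; apply/andP => -[].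
  by case/isolated_removeP=> /negP.
have symG : connect_sym (@adj G) by apply: sym_connect_sym; apply: adj_sym.
(* If [y] is unreachable from [x], the component [D] of [x] and its complement are both closed and
   nonempty, hence both odd, so [#|G|] would be even. *)
apply: contraT => xy; pose D := [set z | connect adj x z].
have closD a b : adj a b -> (a \in D) = (b \in D).
  by move=> /connect1 ab; rewrite !inE (same_connect_r symG ab).
have odD : odd #|D| by apply: (@equatable_closed_odd G D x); rewrite ?inE.
have odC : odd #|~: D|.
  apply: (@equatable_closed_odd G (~: D) y) => //; rewrite ?inE // => a b ab.
  by rewrite !in_setC (closD a b ab).
by move: oddG; rewrite -(cardsC D) oddD odD odC.
Qed.
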